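(* Let $X=[0,1]$ with the Borel $\sigma$-field $\mathscr B$ and the Lebesgue measure $m$. Let $f_1(x)=\frac x2$ and $f_2(x)=\frac x2+\frac12$ for $x\in X$, with probabilities $p_1=p_2=\frac12$, and let $\mathcal L_f=\frac12\mathcal L_1+\frac12\mathcal L_2$, where $\mathcal L_i$ is the Perron--Frobenius operator of $f_i$ on $L^1(m)$. Then $\mathcal L_f$ satisfies (AC), but does not satisfy (C).
   Context: The Perron--Frobenius operator $\mathcal L_g$ of a nonsingular map $g$ is defined by $\int_A\mathcal L_g\varphi\,dm=\int_{g^{-1}(A)}\varphi\,dm$ for all $\varphi\in L^1(m)$, $A\in\mathscr B$. $D(m)=\{h\in L^1(m):h\ge0\ m\text{-a.e.},\ \|h\|=1\}$. (AC) (asymptotically constrictive), for a Markov operator $P$ on $L^1(m)$: for any $\varepsilon>0$ there is $\delta>0$ such that $\limsup_{n\to\infty}\int_AP^n\varphi\,dm<\varepsilon$ for any $\varphi\in D(m)$ and $A\in\mathscr B$ with $m(A)<\delta$. (C) (constrictive): there is a compact set $F\subset L^1(m)$ with $\lim_{n\to\infty}\inf_{\psi\in F}\|P^nh-\psi\|=0$ for every $h\in D(m)$. *)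

(* Defs.v *)
From HB Require Import structures.
From mathcomp Require Import all_boot all_order all_algebra.
From mathcomp Require Import all_classical all_reals all_analysis.
From mathcomp Require Import measurable_realfun.

Set Implicit Arguments.
Unset Strict Implicit.
Unset Printing Implicit Defensive.
Import Order.TTheory GRing.Theory Num.Theory.
Import numFieldNormedType.Exports.
Local Open Scope classical_set_scope.
Local Open Scope ring_scope.

(* The library type [LspaceType1 mu] of classes of integrable functions modulo
   a.e. equality comes without algebraic structure; it is equipped here with
   the usual structure of normed space, norm [fine 'N[mu]_1[_]]. Its elements
   coerce to functions (a representative chosen in the class). *)
Section Lspace1_normedModType.
Context d (T : measurableType d) (R : realType) (mu : {measure set T -> \bar R}).

Local Notation Lfun1 := (LfunType mu (@lexx _ _ 1%E)).
Local Notation L1 := (LspaceType1 mu).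
Local Notation quo := {mfun_ mu, T >-> measurableTypeR R}.

HB.instance Definition _ := gen_eqMixin L1.
HB.instance Definition _ := gen_choiceMixin L1.

Lemma measurable_Lspace1 (F : L1) : measurable_fun setT (F : T -> R).
Proof. exact: measurable_funPT (repr (F : quo)). Qed.

Lemma Lspace1_Lfun (F : L1) : (F : T -> R) \in Lfun mu 1%E.
Proof.
apply/andP; split; rewrite inE/=; first exact: measurable_Lspace1.
exact: Lebesgue_finite.
Qed.

Lemma Lspace1_integrable (F : L1) : mu.-integrable setT (EFin \o (F : T -> R)).
Proof. by apply/Lfun1_integrable; exact: Lspace1_Lfun. Qed.

Definition Lfun_of_Lspace1 (F : L1) : Lfun1 :=
  Lfun_Sub (@lexx _ _ 1%E) (Lspace1_Lfun F).

Let measurable_Lfun (f : Lfun1) : (f : T -> measurableTypeR R) \in mfun.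
Proof. by rewrite inE; exact: (measurable_funPT f). Qed.

Let class_of (f : Lfun1) : quo :=
  (\pi_quo (mfun_Sub (measurable_Lfun f)))%qT.

Let class_ofE (f : Lfun1) : ae_eq mu setT (class_of f : T -> R) (f : T -> R).
Proof.
have /eqmodP/asboolP := reprK (class_of f).
by rewrite /ae_eq => h; exact: h.
Qed.

Let measurable_abs (f : T -> R) : measurable_fun setT f ->
  measurable_fun setT (abse \o (EFin \o f) : T -> \bar R).
Proof.
move=> mf; apply: measurableT_comp; first exact: abse_measurable.
exact/measurable_EFinP.
Qed.

Let class_of_finite (f : Lfun1) : finite_norm mu 1%E (class_of f : T -> R).
Proof.
have := Lfunction_finite (@lexx _ _ 1%E) f; rewrite /finite_norm !Lnorm1.
rewrite (@ae_eq_integral _ _ _ mu setT (abse \o (EFin \o f))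
  (abse \o (EFin \o (class_of f : T -> R))))//.
- exact: measurable_abs (measurable_funPT (repr (class_of f))).
- exact: measurable_abs (measurable_funPT f).
- by apply: filterS (class_ofE f) => x /[apply] /= ->.
Qed.

HB.instance Definition _ (f : Lfun1) :=
  isFinLebesgue.Build d T R mu 1%E (@lexx _ _ 1%E) (class_of f) (class_of_finite f).

Definition Lspace1_of_Lfun (f : Lfun1) : L1 := class_of f.

Lemma Lspace1_of_LfunE (f : Lfun1) :
  \forall x \ae mu, (Lspace1_of_Lfun f : T -> R) x = f x.
Proof. by apply: filterS (class_ofE f) => x; exact. Qed.

Lemma Lspace1P (F G : L1) : F = G <-> \forall x \ae mu, F x = G x.
Proof.
split=> [->|FG]; first exact: aeW.
have FGq : (F : quo) = (G : quo).
  rewrite -(reprK (F : quo)) -(reprK (G : quo)); apply/eqmodP/asboolP.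
  by apply: filterS FG => x Fx _; exact: Fx.
case: F G {FG} FGq => [F [[Ff]]] [G [[Gf]]] /= FG.
by case: _ / FG Gf => Gf; rewrite (Prop_irrelevance Ff Gf).
Qed.

Lemma Lfun_of_Lspace1K : cancel Lfun_of_Lspace1 Lspace1_of_Lfun.
Proof. by move=> F; apply/Lspace1P; exact: Lspace1_of_LfunE. Qed.

Let add (F G : L1) : L1 :=
  Lspace1_of_Lfun (Lfun_of_Lspace1 F + Lfun_of_Lspace1 G).
Let opp (F : L1) : L1 := Lspace1_of_Lfun (- Lfun_of_Lspace1 F).
Let scale (c : R) (F : L1) : L1 := Lspace1_of_Lfun (c *: Lfun_of_Lspace1 F).
Let norm (F : L1) : R := fine 'N[mu]_1[EFin \o (F : T -> R)]%E.

Let Lspace1_of_Lfun_eq (f g : Lfun1) :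
  (\forall x \ae mu, f x = g x) -> Lspace1_of_Lfun f = Lspace1_of_Lfun g.
Proof.
move=> fg; apply/Lspace1P.
apply: filterS3 fg (Lspace1_of_LfunE f) (Lspace1_of_LfunE g).
by move=> x -> -> ->.
Qed.

Let addE f g :
  add (Lspace1_of_Lfun f) (Lspace1_of_Lfun g) = Lspace1_of_Lfun (f + g).
Proof.
apply: Lspace1_of_Lfun_eq.
apply: filterS2 (Lspace1_of_LfunE f) (Lspace1_of_LfunE g) => x fx gx.
exact: congr2 fx gx.
Qed.

Let oppE f : opp (Lspace1_of_Lfun f) = Lspace1_of_Lfun (- f).
Proof.
apply: Lspace1_of_Lfun_eq; apply: filterS (Lspace1_of_LfunE f) => x fx.
exact: congr1 fx.
Qed.

Let scaleE c f : scale c (Lspace1_of_Lfun f) = Lspace1_of_Lfun (c *: f).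
Proof.
apply: Lspace1_of_Lfun_eq; apply: filterS (Lspace1_of_LfunE f) => x fx.
exact: (congr1 ( *%R c) fx).
Qed.

Let normE f : norm (Lspace1_of_Lfun f) = fine 'N[mu]_1[EFin \o f]%E.
Proof.
rewrite /norm !Lnorm1; congr fine; apply: ae_eq_integral => //.
- exact: measurable_abs (measurable_Lspace1 (Lspace1_of_Lfun f)).
- exact: measurable_abs (measurable_funPT f).
- by apply: filterS (Lspace1_of_LfunE f) => x /= ->.
Qed.

Let addA : associative add.
Proof.
move=> F G H.
rewrite -(Lfun_of_Lspace1K F) -(Lfun_of_Lspace1K G) -(Lfun_of_Lspace1K H).
by rewrite !addE addrA.
Qed.

Let addC : commutative add.
Proof. by move=> F G; rewrite /add addrC. Qed.

Let add0 : left_id (Lspace1_of_Lfun 0) add.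
Proof. by move=> F; rewrite -(Lfun_of_Lspace1K F) addE add0r. Qed.

Let addN : left_inverse (Lspace1_of_Lfun 0) opp add.
Proof. by move=> F; rewrite -(Lfun_of_Lspace1K F) oppE addE addNr. Qed.

HB.instance Definition _ := GRing.isZmodule.Build L1 addA addC add0 addN.

Let addrE f g :
  Lspace1_of_Lfun f + Lspace1_of_Lfun g = Lspace1_of_Lfun (f + g).
Proof. exact: addE. Qed.

Let scaleA a b F : scale a (scale b F) = scale (a * b) F.
Proof. by rewrite -(Lfun_of_Lspace1K F) !scaleE scalerA. Qed.

Let scale1 : left_id 1 scale.
Proof. by move=> F; rewrite -(Lfun_of_Lspace1K F) scaleE scale1r. Qed.

Let scaleDr : right_distributive scale +%R.
Proof.
move=> c F G; rewrite -(Lfun_of_Lspace1K F) -(Lfun_of_Lspace1K G).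
by rewrite addrE 3!scaleE addrE scalerDr.
Qed.

Let scaleDl F : {morph scale^~ F : a b / a + b}.
Proof.
move=> a b; rewrite -(Lfun_of_Lspace1K F).
by rewrite !scaleE addrE scalerDl.
Qed.

HB.instance Definition _ :=
  GRing.Zmodule_isLmodule.Build R L1 scaleA scale1 scaleDr scaleDl.

Let scalerE c f : c *: Lspace1_of_Lfun f = Lspace1_of_Lfun (c *: f).
Proof. exact: scaleE. Qed.

Let normD (F G : L1) : norm (F + G) <= norm F + norm G.
Proof.
rewrite -(Lfun_of_Lspace1K F) -(Lfun_of_Lspace1K G).
rewrite addrE !normE; exact: ler_LnormD.
Qed.

Let normZ (c : R) (F : L1) : norm (c *: F) = `|c| * norm F.
Proof.
rewrite -(Lfun_of_Lspace1K F) scalerE !normE.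
by rewrite LnormZ fineM// -finite_norm_fine.
Qed.

Let norm0_eq0 (F : L1) : norm F = 0 -> F = 0.
Proof.
rewrite -(Lfun_of_Lspace1K F) normE => /fine_Lnormr_eq0 F0.
by apply: Lspace1_of_Lfun_eq; apply: filterS F0 => x; exact.
Qed.

HB.instance Definition _ := @Lmodule_isNormed.Build R L1 norm normD normZ norm0_eq0.

Lemma Lspace1_norm (F : L1) : `|F| = fine 'N[mu]_1[EFin \o (F : T -> R)]%E.
Proof. by []. Qed.

Lemma Lspace1D (F G : L1) : \forall x \ae mu, (F + G) x = F x + G x.
Proof. exact: Lspace1_of_LfunE. Qed.

Lemma Lspace1Z (c : R) (F : L1) : \forall x \ae mu, (c *: F) x = c * F x.
Proof. exact: Lspace1_of_LfunE. Qed.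

End Lspace1_normedModType.

Section perron_frobenius.
Context d (T : measurableType d) (R : realType).

Definition nonsingular (mu : {measure set T -> \bar R}) (g : T -> T) : Prop :=
  measurable_fun setT g /\
  forall A, measurable A -> mu A = 0%E -> mu (g @^-1` A) = 0%E.

Definition is_perron_frobenius (mu : {measure set T -> \bar R}) (g : T -> T)
    (L : LspaceType1 mu -> LspaceType1 mu) : Prop :=
  forall (phi : LspaceType1 mu) (A : set T), measurable A ->
    (\int[mu]_(x in A) (L phi x)%:E = \int[mu]_(x in g @^-1` A) (phi x)%:E)%E.

Arguments is_perron_frobenius mu g L : clear implicits.

(* Total operator, meaningful when [g] is nonsingular: existence is
   [perron_frobeniusP], uniqueness is [is_perron_frobenius_uniq]. *)
Definition perron_frobenius (mu : {measure set T -> \bar R}) (g : T -> T) :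
    LspaceType1 mu -> LspaceType1 mu :=
  xget (fun=> 0) [set L | is_perron_frobenius mu g L].
Arguments perron_frobenius mu g _ : clear implicits.

Lemma is_perron_frobenius_uniq (mu : {measure set T -> \bar R}) (g : T -> T)
    (L L' : LspaceType1 mu -> LspaceType1 mu) :
  is_perron_frobenius mu g L -> is_perron_frobenius mu g L' -> L = L'.
Proof.
move=> HL HL'; apply/funext => phi; apply/Lspace1P.
have : ae_eq mu setT (EFin \o (L phi : T -> R)) (EFin \o (L' phi : T -> R)).
  apply: integral_ae_eq => //; first exact: Lspace1_integrable.
    by apply/measurable_EFinP; exact: measurable_Lspace1.
  by move=> E _ mE /=; rewrite HL// HL'.
by apply: filterS => x /(_ I)[].
Qed.

Lemma perron_frobeniusP (mu : {sigma_finite_measure set T -> \bar R})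
    (g : T -> T) :
  nonsingular mu g -> is_perron_frobenius mu g (perron_frobenius mu g).
Proof.
move=> [mg nsg].
suff [L HL] : exists L, is_perron_frobenius mu g L.
  by rewrite /perron_frobenius; case: xgetP => [? ? //|/(_ L)].
suff /choice[L HL] : forall phi : LspaceType1 mu, exists psi : LspaceType1 mu,
    forall A, measurable A ->
    (\int[mu]_(x in A) (psi x)%:E = \int[mu]_(x in g @^-1` A) (phi x)%:E)%E.
  by exists L => phi A; exact: HL.
move=> phi.
have mgV A : measurable A -> measurable (g @^-1` A).
  by move=> mA; rewrite -[X in measurable X]setTI; exact: mg.
pose nu := measure_function_pushforward__canonical__charge_Charge
  (induced_charge (Lspace1_integrable phi)) mg.
have numu : nu `<< mu.
  apply/null_content_dominatesP => A mA muA0.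
  rewrite /nu /= /pushforward /induced_charge.
  apply: null_set_integral; [exact: mgV| |exact: nsg].
  apply: measurable_funTS; apply/measurable_EFinP; exact: measurable_Lspace1.
have RNint := Radon_Nikodym_integrable numu.
pose f := fine \o Radon_Nikodym nu mu.
have fE : EFin \o f = Radon_Nikodym nu mu.
  by apply/funext => x /=; rewrite fineK// Radon_Nikodym_fin_num.
have fL : f \in Lfun mu 1%E by apply/Lfun1_integrable; rewrite fE.
exists (Lspace1_of_Lfun (Lfun_Sub (@lexx _ _ 1%E) fL)) => A mA.
transitivity (nu A); last by [].
rewrite (Radon_Nikodym_integral numu mA) -fE.
apply: ae_eq_integral => //.
- apply: measurable_funTS; apply/measurable_EFinP; exact: measurable_Lspace1.
- apply: measurable_funTS; rewrite fE; exact: measurable_int RNint.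
- have := Lspace1_of_LfunE (Lfun_Sub (@lexx _ _ 1%E) fL).
  by apply: filterS => x + _ /= => ->.
Qed.

End perron_frobenius.
Arguments is_perron_frobenius {d T R} mu g L.
Arguments perron_frobenius {d T R} mu g _.

Section constrictivity.
Context d (T : measurableType d) (R : realType) (mu : {measure set T -> \bar R}).

Definition densities : set (LspaceType1 mu) :=
  [set h : LspaceType1 mu | (\forall x \ae mu, 0 <= h x) /\ `|h| = 1].

Definition asymptotically_constrictive
    (P : LspaceType1 mu -> LspaceType1 mu) : Prop :=
  forall eps : R, 0 < eps -> exists2 delta : R, 0 < delta &
    forall (phi : LspaceType1 mu) (A : set T),
      densities phi -> measurable A -> (mu A < delta%:E)%E ->
      (limn_esup (fun n => \int[mu]_(x in A) (iter n P phi x)%:E) < eps%:E)%E.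

(* The infimum is taken in the extended reals, where it is [+oo] on the empty
   set (the infimum of the empty set of reals is [0] in the library). *)
Definition constrictive (P : LspaceType1 mu -> LspaceType1 mu) : Prop :=
  exists2 F : set (LspaceType1 mu), compact F &
    forall h : LspaceType1 mu, densities h ->
      ereal_inf [set `|iter n P h - psi|%:E | psi in F] @[n --> \oo] --> 0%E.

End constrictivity.

Section unit_interval.
Variable R : realType.

Definition unit_interval : Type := `[0 : R, 1]%classic.

Definition unit_val : unit_interval -> R := set_val.

Lemma unit_valP (x : unit_interval) : 0 <= unit_val x <= 1.
Proof. by have := set_valP x; rewrite /= in_itv. Qed.

Lemma unit_val_inj : injective unit_val.
Proof. exact: val_inj. Qed.

Let unit_interval0 : (0 : R) \in `[0 : R, 1]%classic.
Proof. by rewrite inE/= in_itv/= lexx ler01. Qed.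

HB.instance Definition _ := Choice.on unit_interval.
HB.instance Definition _ := isPointed.Build unit_interval (SigSub unit_interval0).

(* The Borel sets of the subspace [0, 1] are the traces of those of [R]. *)
HB.instance Definition _ := Measurable.copy unit_interval
  (g_sigma_algebra_preimageType unit_val).

Definition lebesgue_unit (A : set unit_interval) : \bar R :=
  lebesgue_measure (unit_val @` A).

Lemma measurable_unit_interval (A : set unit_interval) :
  measurable A -> measurable (unit_val @` A : set R).
Proof.
move=> [B mB <-]; rewrite setTI.
suff -> : unit_val @` (unit_val @^-1` B) = `[0 : R, 1]%classic `&` B.
  by apply: measurableI => //; exact: measurable_itv.
apply/seteqP; split => [_ [x Bx <-]|x [x01 Bx]].
  by split => //; exact: unit_valP.
by exists (SigSub (mem_set x01)).
Qed.

Let lebesgue_unit0 : lebesgue_unit set0 = 0%E.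
Proof. by rewrite /lebesgue_unit image_set0 measure0. Qed.

Let lebesgue_unit_ge0 A : (0 <= lebesgue_unit A)%E.
Proof. exact: measure_ge0. Qed.

Let lebesgue_unit_sigma_additive : semi_sigma_additive lebesgue_unit.
Proof.
move=> F mF tF mUF; rewrite /lebesgue_unit image_bigcup.
apply: measure_semi_sigma_additive => [n| |].
- exact: measurable_unit_interval.
- apply/trivIsetP => i j _ _ ij; rewrite -subset0 => _ [[x Fx <-] [y Fy]].
  move=> /unit_val_inj yx; rewrite yx in Fy.
  by move/trivIsetP : tF => /(_ i j I I ij); rewrite -subset0 => /(_ x); exact.
- by rewrite -image_bigcup; exact: measurable_unit_interval.
Qed.

HB.instance Definition _ := isMeasure.Build _ _ _ lebesgue_unit
  lebesgue_unit0 lebesgue_unit_ge0 lebesgue_unit_sigma_additive.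

Let lebesgue_unitT : lebesgue_unit setT = 1%E.
Proof.
rewrite /lebesgue_unit (_ : _ @` _ = `[0 : R, 1]%classic).
  by rewrite lebesgue_measure_itv/= lte_fin ltr01 -EFinB subr0.
apply/seteqP; split => [_ [x _ <-]|x x01]; first exact: unit_valP.
by exists (SigSub (mem_set x01)).
Qed.

HB.instance Definition _ :=
  Measure_isProbability.Build _ _ _ lebesgue_unit lebesgue_unitT.

Let halfl_subproof (x : unit_interval) : unit_val x / 2 \in `[0 : R, 1]%classic.
Proof.
have := unit_valP x; rewrite inE/= !in_itv/= => /andP[x0 x1].
by rewrite divr_ge0//= ler_pdivrMr// mul1r (le_trans x1)// ler1n.
Qed.

Definition halfl (x : unit_interval) : unit_interval := SigSub (halfl_subproof x).

Let halfr_subproof (x : unit_interval) :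
  unit_val x / 2 + 1 / 2 \in `[0 : R, 1]%classic.
Proof.
have := unit_valP x; rewrite inE/= !in_itv/= => /andP[x0 x1].
by rewrite addr_ge0 ?divr_ge0//= -mulrDl ler_pdivrMr// mul1r lerD2r.
Qed.

Definition halfr (x : unit_interval) : unit_interval := SigSub (halfr_subproof x).

End unit_interval.
Arguments lebesgue_unit : clear implicits.
Arguments halfl {R} x.
Arguments halfr {R} x.

(* Main.v *)
Require Import Defs.
From mathcomp Require Import all_boot all_order all_algebra.
From mathcomp Require Import all_classical all_reals all_analysis.
From mathcomp Require Import measurable_realfun.
From mathcomp Require Import lra.
Import Order.TTheory GRing.Theory Num.Theory.
Import numFieldNormedType.Exports.
Local Open Scope classical_set_scope.
Local Open Scope ring_scope.

Set Implicit Arguments.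
Unset Strict Implicit.

(** The two branches are the inverse branches of the doubling map [D] of the
unit interval, so the averaged operator is composition with [D]: it sends
[phi] to [phi \o D], up to null sets.

(AC) holds because [D] is mixing: the masses of [A] under the iterates of a
density tend to [m A] for every Borel set [A]
([iter_half_transfer_mixing]), so that [delta := eps] works.  Mixing is read
off a recursion for these masses that never mentions [D]: the mass of [A] at
time [n + 1] is the mean of the masses at time [n] of its preimages under
[x / 2] and [x / 2 + 1 / 2] ([Rintegral_half_transfer]).  On a ray
[x < c] one of the two preimages is empty or everything, and Lebesgue measure
obeys the same recursion ([lebesgue_unit_halves]); hence the distance of the
distribution functions is halved at each step
([iter_half_transfer_ray]).  A Dynkin class argument carries the convergence
from rays to Borel sets ([cvg_finite_measure_setI_closed]).  It needs the
masses to be absolutely continuous uniformly in [n], and such a bound passes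
through the recursion unchanged ([iter_half_transfer_equiintegrable]).

(C) fails because the convergence is only weak.  Start from the normalized
indicator function [h] of the lower half: its [n]-th iterate is concentrated
on a set of measure [1 / 2] ([exists_concentration_set]).  If the iterates of
[h] approached a compact set, some [psi] would be close in norm to infinitely
many of them; by mixing [psi] would have mass about [m A] on every [A], by
closeness it would have mass about [1] on a set of measure [1 / 2], which is
impossible. *)

(** * Convergence of set functions from a pi-system to a sigma-algebra *)

(** The class of sets where the convergence holds is a lambda-system: the bound
[M * mu A + e], uniform in [n], makes the part of an increasing union beyond
a late stage small for all [nu n] at once.  The [nu n] are plain real-valued
functions, subtractive and nonnegative on measurable sets, so that integrals
can be used without packing them as measures. *)
Lemma cvg_finite_measure_setI_closed d (T : measurableType d) (R : realType)
    (mu : {finite_measure set T -> \bar R}) (G : set (set T))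
    (nu : nat -> set T -> R) :
  measurable = <<s G >> -> setI_closed G ->
  (forall n A, measurable A -> 0 <= nu n A) ->
  (forall n A B, measurable A -> measurable B -> B `<=` A ->
    nu n (A `\` B) = nu n A - nu n B) ->
  (forall e : R, 0 < e -> exists M : R, forall n A, measurable A ->
    nu n A <= M * fine (mu A) + e) ->
  (nu n setT @[n --> \oo] --> fine (mu setT)) ->
  (forall A, G A -> nu n A @[n --> \oo] --> fine (mu A)) ->
  forall A, measurable A -> nu n A @[n --> \oo] --> fine (mu A).
Proof.
move=> mG GI nu0 nuD nuM nuT nuG.
have muD A B : measurable A -> measurable B -> B `<=` A ->
    fine (mu (A `\` B)) = fine (mu A) - fine (mu B).
  move=> mA mB BA; rewrite measureD//; last by rewrite ltey_eq fin_num_measure.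
  by rewrite (setIidr BA) fineB// fin_num_measure.
suff sub : <<s G >> `<=` [set A | measurable A /\
    (nu n A @[n --> \oo] --> fine (mu A))].
  by move=> A; rewrite {1}mG => /sub[].
apply: lambda_system_subset => //; first last.
  by move=> A GA; split; [rewrite mG; exact: sub_sigma_algebra|exact: nuG].
split => //.
- move=> A B BA [mA cA] [mB cB]; split; first exact: measurableD.
  rewrite muD//; under eq_fun do rewrite nuD//.
  exact: cvgB.
move=> F Fnd HF.
have mF k : measurable (F k) by case: (HF k).
have mU : measurable (\bigcup_i F i) by exact: bigcupT_measurable.
split => //.
apply/cvgrPdist_lt => e e0.
have [M nuMe] := nuM (e / 4) (divr_gt0 e0 (ltr0n _ 4)).
have M0 : 0 < `|M| + 1 by rewrite ltr_wpDl.
(* With [+ 1], a set of measure less than [eta] has both its measure and [`|M|]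
   times its measure below [e / 4], also when [M = 0]. *)
pose eta := e / 4 / (`|M| + 1).
have eta0 : 0 < eta by rewrite !divr_gt0.
have cF : (fine \o (mu \o F)) k @[k --> \oo] --> fine (mu (\bigcup_i F i)).
  apply: fine_cvg; rewrite fineK ?fin_num_measure//.
  exact: nondecreasing_cvg_mu.
have [k _ /(_ k (leqnn k)) /=] :=
  (cvgrPdist_lt _ _).1 cF eta eta0.
have FU : F k `<=` \bigcup_i F i by exact: bigcup_sup.
set u := fine (mu (\bigcup_i F i)); set v := fine (mu (F k)) => uv.
have Dk : fine (mu (\bigcup_i F i `\` F k)) = u - v by rewrite muD.
have Dk0 : 0 <= u - v by rewrite -Dk fine_ge0.
rewrite ger0_norm// in uv.
have Mk : (`|M| + 1) * (u - v) < e / 4 by rewrite mulrC -ltr_pdivlMr.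
have MMk : M * (u - v) <= `|M| * (u - v) by rewrite ler_wpM2r// ler_norm.
have Mk0 : 0 <= `|M| * (u - v) by rewrite mulr_ge0.
near=> n.
have nk : `|v - nu n (F k)| < e / 4.
  near: n; apply: (cvgrPdist_lt _ _).1; last by rewrite divr_gt0.
  by case: (HF k).
have mDk := measurableD mU (mF k).
have := nuMe n _ mDk; have := nu0 n _ mDk; rewrite Dk nuD//.
move: nk; rewrite !ltr_distl.
move: (nu n (F k)) (nu n (\bigcup_i F i)) => a b /andP[] *.
rewrite mulrDl mul1r in Mk.
by apply/andP; split; lra.
Unshelve. all: by end_near. Qed.

(** * Rays and half-scalings of the unit interval *)

Section rays.
Variable R : realType.
Notation m := (lebesgue_unit R : {measure set (unit_interval R) -> \bar R}).
Implicit Type c : R.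

Definition ray c : set (unit_interval R) := [set x | unit_val x < c].

Lemma measurable_unit_interval_rays :
  @measurable _ (unit_interval R) = <<s range ray >>.
Proof.
transitivity (preimage_set_system setT (@unit_val R)
  ((@RGenInftyO.G R).-sigma.-measurable)).
  by rewrite -RGenInftyO.measurableE.
rewrite -g_sigma_preimageE; congr (smallest _ _).
apply/seteqP; split => [_ [_ [c ->] <-]|_ [c _ <-]].
  by exists c => //; rewrite setTI; apply/seteqP; split => x /=; rewrite in_itv.
exists `]-oo, c[%classic; first by exists c.
by rewrite setTI; apply/seteqP; split => x /=; rewrite in_itv.
Qed.

Lemma measurable_ray c : measurable (ray c).
Proof.
by rewrite measurable_unit_interval_rays; apply: sub_sigma_algebra; exists c.
Qed.

Lemma measurable_unit_val : measurable_fun setT (@unit_val R).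
Proof. by move=> _ B mB; rewrite setTI; exists B => //; rewrite setTI. Qed.

Lemma setI_closed_rays : setI_closed (range ray).
Proof.
move=> _ _ [a _ <-] [b _ <-]; exists (Num.min a b) => //.
by apply/seteqP; split => x /=; rewrite /ray/= lt_min => /andP.
Qed.

Lemma ray_le0 c : c <= 0 -> ray c = set0.
Proof.
move=> c0; rewrite -subset0 => x /=; rewrite /ray /=.
have /andP[x0 _] := unit_valP x.
by move=> /lt_le_trans => /(_ _ c0); rewrite ltNge x0.
Qed.

Lemma ray_gt1 c : 1 < c -> ray c = setT.
Proof.
move=> c1; rewrite -subTset => x _; rewrite /ray /=.
by have /andP[_ x1] := unit_valP x; exact: le_lt_trans c1.
Qed.

Lemma lebesgue_unit_ray c : 0 <= c <= 1 -> m (ray c) = c%:E.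
Proof.
move=> /andP[c0 c1].
transitivity (lebesgue_measure (@unit_val R @` ray c)) => //.
rewrite (_ : _ @` _ = `[0, c[%classic).
  by rewrite lebesgue_measure_itv/= lte_fin; case: ltP => [_|c0'];
    rewrite ?sube0 ?EFinN// -?EFinB ?subr0//; congr EFin; lra.
apply/seteqP; split => [_ [x xc <-]|x /=]; rewrite /= in_itv/=.
  by have /andP[-> _] := unit_valP x.
move=> /andP[x0 xc]; have x01 : x \in `[0, 1]%classic.
  by rewrite inE/= in_itv/= x0/= ltW// (lt_le_trans xc).
by exists (SigSub x01).
Qed.

(** For every [c], one of the endpoints [2 * c] and [2 * c - 1] lies outside the
open unit interval, so only one of the two preimages of a ray matters. *)
Lemma halfl_ray c : halfl @^-1` ray c = ray (2 * c).
Proof.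
by apply/seteqP; split => x; rewrite /ray/= ltr_pdivrMr// mulrC.
Qed.

Lemma unit_val_halfr x : unit_val (@halfr R x) = unit_val x / 2 + 1 / 2.
Proof. by []. Qed.

Lemma halfr_ray c : halfr @^-1` ray c = ray (2 * c - 1).
Proof.
by apply/seteqP; split => x; rewrite /ray/= unit_val_halfr => h; lra.
Qed.

Lemma measurable_halfl : measurable_fun setT (@halfl R).
Proof.
apply: (measurability _ measurable_unit_interval_rays).
by move=> _ [_ [c _ <-] <-]; rewrite setTI halfl_ray; exact: measurable_ray.
Qed.

Lemma measurable_halfr : measurable_fun setT (@halfr R).
Proof.
apply: (measurability _ measurable_unit_interval_rays).
by move=> _ [_ [c _ <-] <-]; rewrite setTI halfr_ray; exact: measurable_ray.
Qed.

Lemma measurable_halfl_preimage (A : set (unit_interval R)) :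
  measurable A -> measurable (halfl @^-1` A).
Proof.
by move=> mA; rewrite -[X in measurable X]setTI; exact: measurable_halfl.
Qed.

Lemma measurable_halfr_preimage (A : set (unit_interval R)) :
  measurable A -> measurable (halfr @^-1` A).
Proof.
by move=> mA; rewrite -[X in measurable X]setTI; exact: measurable_halfr.
Qed.

Let lebesgue_unit_fin A : measurable A -> m A \is a fin_num.
Proof. exact: (fin_num_measure (lebesgue_unit R)). Qed.

Lemma lebesgue_unitT : m setT = 1%E.
Proof. exact: (probability_setT (lebesgue_unit R)). Qed.

Lemma ray_case c : [\/ c <= 0, 0 <= c <= 1 | 1 < c].
Proof.
have [c0|c0] := leP c 0; first exact: Or31.
by have [c1|c1] := leP c 1; [apply: Or32; rewrite ltW|exact: Or33].
Qed.

(** This is the invariance of Lebesgue measure under the doubling map.  Both sides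
are measures that agree on rays, where the formula is a computation with
endpoints; it is stated without a factor [1 / 2] so that both are sums of two
measures. *)
Lemma lebesgue_unit_halves A : measurable A ->
  fine (m (halfl @^-1` A)) + fine (m (halfr @^-1` A)) = 2 * fine (m A).
Proof.
move=> mA.
pose mP : {measure set _ -> \bar R} :=
  measure_function_pushforward__canonical__measure_function_Measure m
    measurable_halfl.
pose mQ : {measure set _ -> \bar R} :=
  measure_function_pushforward__canonical__measure_function_Measure m
    measurable_halfr.
pose m1 : {measure set _ -> \bar R} := measure_add mP mQ.
pose m2 : {measure set _ -> \bar R} := measure_add m m.
have m1E B : (m1 B = m (halfl @^-1` B) + m (halfr @^-1` B))%E.
  exact: measure_addE.
have m2E B : (m2 B = m B + m B)%E by exact: measure_addE.
have m12ray c : m1 (ray c) = m2 (ray c).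
  rewrite m1E m2E halfl_ray halfr_ray.
  have [c0|c01|c1] := ray_case c.
  - by rewrite !(@ray_le0 c) ?(@ray_le0 (2 * c)) ?(@ray_le0 (2 * c - 1))//; lra.
  - have [c2|c2] := leP c (1 / 2).
      rewrite (@ray_le0 (2 * c - 1)) ?measure0 ?adde0; last lra.
      by rewrite !lebesgue_unit_ray -?EFinD; [congr EFin|..]; lra.
    rewrite (@ray_gt1 (2 * c)); last lra.
    by rewrite lebesgue_unitT !lebesgue_unit_ray -?EFinD; [congr EFin|..]; lra.
  - by rewrite !ray_gt1//; lra.
have : m1 A = m2 A.
  apply: (@measure_unique _ _ _ (range ray) (fun=> ray 2)) => //.
  - exact: measurable_unit_interval_rays.
  - exact: setI_closed_rays.
  - by rewrite -subTset => x _; exists 0%N => //; rewrite ray_gt1// ltr1n.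
  - by move=> _ [c _ <-].
  - move=> _; rewrite ray_gt1 ?ltr1n// m1E !preimage_setT.
    by rewrite lebesgue_unitT -EFinD ltry.
rewrite m1E m2E.
have mlA := measurable_halfl_preimage mA.
have mrA := measurable_halfr_preimage mA.
move=> /(congr1 fine); rewrite !fineD ?lebesgue_unit_fin// => ->.
by rewrite mulr2n mulrDl mul1r.
Qed.

End rays.

(** * Integrals of elements of the space of integrable classes *)

Section Lspace1_integral.
Context d (T : measurableType d) (R : realType) (mu : {measure set T -> \bar R}).
Implicit Types (F G : LspaceType1 mu) (A B : set T).

Lemma Lspace1_integrable_on F A : measurable A ->
  mu.-integrable A (EFin \o (F : T -> R)).
Proof.
move=> mA; apply: (integrableS measurableT) => //; exact: Lspace1_integrable.
Qed.

Lemma eq_ae_Rintegral A (f g : T -> R) : measurable A ->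
    measurable_fun setT f -> measurable_fun setT g ->
  (\forall x \ae mu, f x = g x) ->
  \int[mu]_(x in A) f x = \int[mu]_(x in A) g x.
Proof.
move=> mA mf mg fg; rewrite /Rintegral; congr fine; apply: ae_eq_integral => //.
- by apply: measurable_funTS; exact/measurable_EFinP.
- by apply: measurable_funTS; exact/measurable_EFinP.
- by apply: filterS fg => x /= -> _.
Qed.

Lemma Rintegral_Lspace1_lin (a b : R) F G A : measurable A ->
  \int[mu]_(x in A) (a *: F + b *: G) x =
  a * \int[mu]_(x in A) F x + b * \int[mu]_(x in A) G x.
Proof.
move=> mA.
have mF := measurable_Lspace1 F; have mG := measurable_Lspace1 G.
have iF := Lspace1_integrable_on F mA; have iG := Lspace1_integrable_on G mA.
rewrite (@eq_ae_Rintegral _ _ (fun x => a * F x + b * G x)) //.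
- rewrite RintegralD ?RintegralZl//.
    exact: (@integrableZl _ _ _ _ _ mA a _ iF).
  exact: (@integrableZl _ _ _ _ _ mA b _ iG).
- exact: measurable_Lspace1.
- by apply: measurable_funD; apply: measurable_funM.
- apply: filterS3 (Lspace1D (a *: F) (b *: G)) (Lspace1Z a F) (Lspace1Z b G).
  by move=> x -> -> ->.
Qed.

Lemma Rintegral_setD F A B : measurable A -> measurable B -> B `<=` A ->
  \int[mu]_(x in A `\` B) F x =
  \int[mu]_(x in A) F x - \int[mu]_(x in B) F x.
Proof.
move=> mA mB BA; apply/eqP; rewrite eq_sym subr_eq; apply/eqP.
rewrite -{1}(setDUK BA) setUC Rintegral_setU//.
- exact: measurableD.
- by apply: Lspace1_integrable_on; rewrite setUC setDUK.
- by rewrite disj_set2E setDKI.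
Qed.

Lemma Lspace1_norm_Rintegral F : `|F| = \int[mu]_x `|F x|.
Proof. by rewrite Lspace1_norm Lnorm1. Qed.

Lemma ge0_Lspace1_norm F : (\forall x \ae mu, 0 <= F x) -> `|F| = \int[mu]_x F x.
Proof.
move=> F0; rewrite Lspace1_norm_Rintegral; apply: eq_ae_Rintegral => //.
- by apply: measurableT_comp => //; exact: measurable_Lspace1.
- exact: measurable_Lspace1.
- by apply: filterS F0 => x /ger0_norm.
Qed.

Lemma normr_Rintegral_le_norm F A : measurable A ->
  `|\int[mu]_(x in A) F x| <= `|F|.
Proof.
move=> mA; apply: (le_trans (le_normr_Rintegral mA (Lspace1_integrable_on F mA))).
rewrite Lspace1_norm_Rintegral /Rintegral.
have iF : (\int[mu]_x `|F x|%:E < +oo)%E.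
  by have /integrableP[] := Lspace1_integrable F.
have mabs : measurable_fun setT (fun x => `|F x|%:E).
  by apply/measurable_EFinP; apply: measurableT_comp => //;
    exact: measurable_Lspace1.
have AT : (\int[mu]_(x in A) `|F x|%:E <= \int[mu]_x `|F x|%:E)%E.
  by apply: ge0_subset_integral.
apply: fine_le => //; rewrite ge0_fin_numE//; try exact: integral_ge0.
exact: le_lt_trans iF.
Qed.

Lemma ae_ge0_Rintegral F A : measurable A -> (\forall x \ae mu, 0 <= F x) ->
  0 <= \int[mu]_(x in A) F x.
Proof.
move=> mA F0; have mF := measurable_Lspace1 F.
rewrite (@eq_ae_Rintegral _ _ (fun x => `|F x|)) //.
- exact: Rintegral_ge0.
- exact: measurableT_comp.
- by apply: filterS F0 => x /ger0_norm.
Qed.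

(** Absolute continuity of the integral, in a form linear in [mu A]: sets of
measure below [d0] contribute less than [e], and on the others the total mass is at
most [`|F| / d0] times the measure.  Linearity is what lets the bound survive
averaging over preimages. *)
Lemma Rintegral_le_affine F : (\forall x \ae mu, 0 <= F x) ->
  forall e : R, 0 < e -> exists2 M : R, 0 <= M & forall A, measurable A ->
    mu A \is a fin_num -> \int[mu]_(x in A) F x <= M * fine (mu A) + e.
Proof.
move=> F0 e e0.
have [d0 [d00 Hd]] := integral_normr_continuous (Lspace1_integrable F) e0.
exists (`|F| / d0) => [|A mA fA]; first by rewrite divr_ge0// ltW.
have [Ad|dA] := ltP (mu A) d0%:E.
  apply: (@le_trans _ _ e).
    apply: le_trans (ltW (Hd A mA Ad)).
    apply: le_trans (ler_norm _) _.
    exact: le_normr_Rintegral mA (Lspace1_integrable_on F mA).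
  by rewrite lerDr mulr_ge0 ?fine_ge0// divr_ge0// ltW.
apply: (@le_trans _ _ `|F|).
  exact: le_trans (ler_norm _) (normr_Rintegral_le_norm F mA).
rewrite -[leLHS]addr0 lerD ?(ltW e0)// mulrAC ler_pdivlMr// ler_wpM2l//.
by rewrite -lee_fin fineK.
Qed.

End Lspace1_integral.

(** * Mixing of the averaged transfer operator *)

Section transfer.
Variable R : realType.
Notation m := (lebesgue_unit R : {measure set (unit_interval R) -> \bar R}).
Implicit Types (phi : LspaceType1 m) (A : set (unit_interval R)) (c : R).

Definition half_transfer phi : LspaceType1 m :=
  (1 / 2 : R) *: perron_frobenius m halfl phi +
  (1 / 2 : R) *: perron_frobenius m halfr phi.

Let m_fin A : measurable A -> m A \is a fin_num.
Proof. exact: (fin_num_measure (lebesgue_unit R)). Qed.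

Lemma nonsingular_halves : nonsingular m halfl /\ nonsingular m halfr.
Proof.
split; (split; [exact: measurable_halfl || exact: measurable_halfr|]) => A mA A0.
all: have := lebesgue_unit_halves mA; rewrite A0 /= mulr0.
all: have mlA := measurable_halfl_preimage mA.
all: have mrA := measurable_halfr_preimage mA.
all: move=> /eqP; rewrite paddr_eq0 ?fine_ge0// => /andP[/eqP lA0 /eqP rA0].
  by rewrite -[LHS]fineK ?m_fin// lA0.
by rewrite -[LHS]fineK ?m_fin// rA0.
Qed.

Lemma Rintegral_half_transfer phi A : measurable A ->
  \int[m]_(x in A) half_transfer phi x =
  (\int[m]_(x in halfl @^-1` A) phi x +
   \int[m]_(x in halfr @^-1` A) phi x) / 2.
Proof.
move=> mA; rewrite Rintegral_Lspace1_lin// -mulrDr mulrC mul1r.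
have [nl nr] := nonsingular_halves.
have Hl := @perron_frobeniusP _ _ _ (lebesgue_unit R) _ nl phi A mA.
have Hr := @perron_frobeniusP _ _ _ (lebesgue_unit R) _ nr phi A mA.
by congr ((_ + _) / _); rewrite /Rintegral; congr fine.
Qed.

Notation nu phi n A := (\int[m]_(x in A) iter n half_transfer phi x).

Lemma iter_half_transfer phi n A : measurable A ->
  nu phi n.+1 A = (nu phi n (halfl @^-1` A) + nu phi n (halfr @^-1` A)) / 2.
Proof. exact: Rintegral_half_transfer. Qed.

Section density.
Variable phi : LspaceType1 m.
Hypothesis phiD : densities phi.

Let phi0 : \forall x \ae m, 0 <= phi x. Proof. by case: phiD. Qed.

Lemma iter_half_transfer_ge0 n A : measurable A -> 0 <= nu phi n A.
Proof.
elim: n A => [|n IH] A mA; first exact: ae_ge0_Rintegral.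
rewrite iter_half_transfer// divr_ge0// addr_ge0// IH//.
  exact: measurable_halfl_preimage.
exact: measurable_halfr_preimage.
Qed.

Lemma iter_half_transferT n : nu phi n setT = 1.
Proof.
elim: n => [|n IH]; first by rewrite -ge0_Lspace1_norm//; case: phiD.
rewrite iter_half_transfer// !preimage_setT.
by rewrite IH; lra.
Qed.

(** A preimage may have twice the measure of [A], so smallness of [m A] is not
inherited directly; but the measures of the two preimages sum to [2 * m A], and
an affine bound is reproduced with the same [M] and [e]. *)
Lemma iter_half_transfer_equiintegrable (e : R) : 0 < e ->
  exists M : R, forall n A, measurable A -> nu phi n A <= M * fine (m A) + e.
Proof.
move=> e0; have [M M0 HM] := Rintegral_le_affine phi0 e0.
exists M; elim=> [|n IH] A mA; first by apply: HM => //; exact: m_fin.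
have mlA := measurable_halfl_preimage mA.
have mrA := measurable_halfr_preimage mA.
rewrite iter_half_transfer//; have := IH _ mlA; have := IH _ mrA.
rewrite ler_pdivrMr// mulrDl -mulrA [fine _ * 2]mulrC -lebesgue_unit_halves//.
by move=> ? ?; lra.
Qed.

(** Of the two preimages of [ray c], one is empty (when [c <= 1 / 2]) or everything
(when [1 / 2 < c]), where the two masses agree; the averaging thus halves the
error carried by the other. *)
Lemma iter_half_transfer_ray n c :
  `|nu phi n (ray c) - fine (m (ray c))| <= (2^-1) ^+ n.
Proof.
elim: n c => [|n IH] c.
  have h1 := iter_half_transfer_ge0 0 (measurable_ray c).
  have h3 : nu phi 0 (ray c) <= 1.
    have := iter_half_transfer_ge0 0
      (measurableD measurableT (measurable_ray c)).
    rewrite Rintegral_setD//; last exact: measurable_ray.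
    by rewrite iter_half_transferT subr_ge0.
  have h4 : fine (m (ray c)) <= 1.
    rewrite -[leRHS]/(fine 1%E) -lebesgue_unitT.
    by rewrite fine_le ?m_fin// ?le_measure ?inE//; exact: measurable_ray.
  have h5 : 0 <= fine (m (ray c)) by rewrite fine_ge0.
  move: h1 h3 h4 h5; rewrite expr0 ler_norml.
  by move: (fine _) (Rintegral _ _ _) => u v *; apply/andP; split; lra.
rewrite iter_half_transfer; last exact: measurable_ray.
have := lebesgue_unit_halves (measurable_ray c).
rewrite halfl_ray halfr_ray exprS.
have [c2|c2] := leP c (1 / 2).
  rewrite (@ray_le0 _ (2 * c - 1)) ?measure0 ?Rintegral_set0; last lra.
  have := IH (2 * c); rewrite !ler_norml.
  move: (fine (m (ray c))) (fine (m (ray (2 * c)))) (Rintegral _ _ _) => u v w.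
  by move=> /andP[? ?] /= ?; apply/andP; split; lra.
rewrite (@ray_gt1 _ (2 * c)); last lra.
rewrite lebesgue_unitT iter_half_transferT.
have := IH (2 * c - 1); rewrite !ler_norml.
move: (fine (m (ray c))) (fine (m (ray (2 * c - 1)))) (Rintegral _ _ _) => u v w.
by move=> /andP[? ?] /= ?; apply/andP; split; lra.
Qed.

Lemma iter_half_transfer_mixing A : measurable A ->
  nu phi n A @[n --> \oo] --> fine (m A).
Proof.
apply: (@cvg_finite_measure_setI_closed _ _ R (lebesgue_unit R)
  (range (@ray R)) (fun n A => nu phi n A)).
- exact: measurable_unit_interval_rays.
- exact: setI_closed_rays.
- exact: iter_half_transfer_ge0.
- by move=> n B C mB mC; exact: Rintegral_setD.
- exact: iter_half_transfer_equiintegrable.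
- rewrite -/(m setT) lebesgue_unitT; under eq_fun do rewrite iter_half_transferT.
  exact: cvg_cst.
move=> _ [c _ <-]; apply/cvgrPdist_le => e e0.
have : (fun n => (2^-1 : R) ^+ n) @ \oo --> (0 : R).
  by apply: cvg_expr; rewrite ger0_norm// invf_lt1// ltr1n.
move=> /cvgrPdist_le /(_ e e0); apply: filterS => n.
rewrite sub0r normrN ger0_norm ?exprn_ge0// => he; apply: le_trans he.
rewrite distrC.
exact: iter_half_transfer_ray.
Qed.

End density.

(** The limit superior is the limit [m A] itself, so [delta := eps] will do. *)
Lemma half_transfer_AC : asymptotically_constrictive half_transfer.
Proof.
move=> e e0; exists e => // phi A phiD mA Ae.
have cv : (\int[m]_(x in A) (iter n half_transfer phi x)%:E)%E @[n --> \oo]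
    --> m A.
  rewrite -(fineK (m_fin mA)).
  rewrite (_ : (fun n => _) = EFin \o (fun n => nu phi n A)).
    by apply: cvg_EFin; [exact: nearW|exact: iter_half_transfer_mixing].
  apply/funext => n /=; rewrite /Rintegral fineK//.
  exact: (@integrable_fin_num _ _ _ _ _ mA _
    (Lspace1_integrable_on (iter n half_transfer phi) mA)).
by rewrite (cvg_limn_einf_sup cv).
Qed.

End transfer.

(** * Failure of constrictivity *)

Section not_constrictive.
Variable R : realType.
Notation m := (lebesgue_unit R : {measure set (unit_interval R) -> \bar R}).
Implicit Types (phi : LspaceType1 m) (A : set (unit_interval R)) (B : set R).
Notation trace B := (@unit_val R @^-1` B).
Notation nu phi n A := (\int[m]_(x in A) iter n (@half_transfer R) phi x).

Lemma measurable_trace B : measurable B -> measurable (trace B).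
Proof.
by move=> mB; rewrite -[X in measurable X]setTI; exact: measurable_unit_val.
Qed.

Lemma lebesgue_unit_lower_half : m (trace `]0, (1 / 2)[) = (1 / 2)%:E.
Proof.
transitivity (lebesgue_measure (@unit_val R @` (trace `]0, (1 / 2)[))) => //.
rewrite (_ : _ @` _ = `]0, (1 / 2)[%classic).
  by rewrite lebesgue_measure_itv/= lte_fin divr_gt0// -EFinB subr0.
apply/seteqP; split => [_ [x xc <-] //|x xB].
have x01 : x \in `[0, 1]%classic.
  by move: xB; rewrite inE/= !in_itv/= => /andP[? ?]; apply/andP; split; lra.
by exists (SigSub x01).
Qed.

(** [B'] is the preimage of [B] under the doubling map, both of whose restrictions
are inverted by the half-scalings.  Keeping away from the endpoints [0] and [1]
makes the two equalities exact: the branches meet at [1 / 2], the image of [1]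
under the one and of [0] under the other. *)
Lemma exists_doubling_preimage B : measurable B -> B `<=` `]0, 1[ ->
  exists B', [/\ measurable B', B' `<=` `]0, 1[,
    halfl @^-1` (trace B') = trace B & halfr @^-1` (trace B') = trace B].
Proof.
move=> mB B01.
exists ((fun y => 2 * y) @^-1` B `|` (fun y => 2 * y - 1) @^-1` B); split.
- apply: measurableU; rewrite -[X in measurable X]setTI.
    by apply: (_ : measurable_fun setT (fun y : R => 2 * y)) => //;
      exact: measurable_funM.
  by apply: (_ : measurable_fun setT (fun y : R => 2 * y - 1)) => //;
    apply: measurable_funB => //; exact: measurable_funM.
- by move=> y /= [] /B01; rewrite /= !in_itv/= => /andP[? ?];
    apply/andP; split; lra.
- apply/seteqP; split => x /=; have /andP[x0 x1] := unit_valP x.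
    have -> : 2 * unit_val (halfl x) = unit_val x by rewrite mulrC divfK.
    by move=> [//|/B01] /=; rewrite in_itv/= => /andP[? ?]; lra.
  by move=> Bx; left; rewrite [2 * _]mulrC divfK.
- apply/seteqP; split => x /=; have /andP[x0 x1] := unit_valP x.
    rewrite unit_val_halfr (_ : 2 * _ - 1 = unit_val x); last lra.
    by move=> [/B01|//] /=; rewrite in_itv/= => /andP[? ?]; lra.
  by move=> Bx; right; rewrite unit_val_halfr (_ : 2 * _ - 1 = unit_val x)//;
    lra.
Qed.

Lemma exists_half_density : exists2 h : LspaceType1 m, densities h &
  \int[m]_(x in trace `]0, (1 / 2)[) h x = 1.
Proof.
set A := trace `]0, (1 / 2)[.
have mA : measurable A by apply: measurable_trace; exact: measurable_itv.
pose f : unit_interval R -> R := fun x => 2 * \1_A x.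
have mf : measurable_fun setT f.
  by apply: measurable_funM => //; exact: measurable_indic.
have iA : m.-integrable setT (EFin \o (\1_A : _ -> R)).
  by apply: integrable_indic => //; rewrite lebesgue_unit_lower_half ltry.
have fL : f \in Lfun m 1%E.
  by apply/Lfun1_integrable; exact: (@integrableZl _ _ _ _ _ measurableT 2 _ iA).
pose h : LspaceType1 m := Lspace1_of_Lfun (Lfun_Sub (@lexx _ _ 1%E) fL).
have hf : \forall x \ae m, h x = f x by exact: Lspace1_of_LfunE.
have h0 : \forall x \ae m, 0 <= h x.
  by apply: filterS hf => x ->; rewrite mulr_ge0.
have hA D : measurable D -> A `<=` D -> \int[m]_(x in D) h x = 1.
  move=> mD AD; rewrite (eq_ae_Rintegral mD _ _ hf)//; last first.
    exact: measurable_Lspace1.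
  rewrite RintegralZl//; last by apply: (integrableS measurableT).
  rewrite /Rintegral integral_indic// (setIidl AD) lebesgue_unit_lower_half /=.
  lra.
exists h; last exact: hA.
by split => //; rewrite ge0_Lspace1_norm// hA.
Qed.

(** The set is the [n]-fold preimage of the lower half under the doubling map: the
transfer operator carries the mass [1] of the lower half along, and invariance
keeps the measure equal to [1 / 2]. *)
Lemma exists_concentration_set (h : LspaceType1 m) :
  \int[m]_(x in trace `]0, (1 / 2)[) h x = 1 ->
  forall n, exists A, [/\ measurable A, fine (m A) = 1 / 2 & nu h n A = 1].
Proof.
move=> h1 n.
suff [B [mB _ mB2 nB]] : exists B, [/\ measurable B, B `<=` `]0, 1[,
    fine (m (trace B)) = 1 / 2 & nu h n (trace B) = 1].
  by exists (trace B); split => //; exact: measurable_trace.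
elim: n => [|n [B [mB B01 mB2 nB]]].
  exists `]0, (1 / 2)[%classic; split => //; last first.
    by rewrite lebesgue_unit_lower_half.
  by move=> x /=; rewrite !in_itv/= => /andP[? ?]; apply/andP; split; lra.
have [B' [mB' B'01 lB' rB']] := exists_doubling_preimage mB B01.
have mtB' := measurable_trace mB'.
exists B'; split => //.
  have := lebesgue_unit_halves mtB'; rewrite lB' rB' mB2.
  by move: (fine _) => u; lra.
by rewrite iter_half_transfer// lB' rB' nB; lra.
Qed.

(** A cluster point, in the compact set, of near-best approximations is within
[1 / 8] of infinitely many iterates; a single such [psi], known up to a fixed
error, already contradicts the gap of [1 / 2] between the masses [1] and
[m A = 1 / 2] of the concentration sets. *)
Lemma half_transfer_not_constrictive : ~ constrictive (@half_transfer R).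
Proof.
move=> [F cF HF].
have [h hD h1] := exists_half_density.
pose hn n := iter n (@half_transfer R) h.
have e16 : (0 : R) < 1 / 16 by lra.
have near_F : \forall n \near \oo, exists psi, F psi /\ `|hn n - psi| < 1 / 16.
  have /fine_cvgP[fin0 /cvgrPdist_lt/(_ _ e16)] := HF h hD.
  apply: filterS2 fin0 => n fin0.
  rewrite sub0r normrN => /(le_lt_trans (ler_norm _)).
  by rewrite -lte_fin fineK// => /ereal_inf_lt[_ [psi Fpsi <-]]; exists psi.
have [psi Fpsi clpsi] : exists2 psi, F psi &
    forall N, exists2 n, (N <= n)%N & `|hn n - psi| < 1 / 8.
  have [N0 _ HN0] := near_F.
  have /choice[u Hu] : forall n, exists psi, (N0 <= n)%N ->
      F psi /\ `|hn n - psi| < 1 / 16.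
    move=> n; have [Nn|_] := boolP (N0 <= n)%N; last by exists 0.
    by have [psi ?] := HN0 n Nn; exists psi.
  have Fu : (u n @[n --> \oo]) F by exists N0 => // n /Hu[].
  have [psi [Fpsi clpsi]] := cF _ _ Fu.
  exists psi => // N.
  have uN : (u n @[n --> \oo]) (u @` [set n | (maxn N N0 <= n)%N]).
    by exists (maxn N N0) => // n Nn; exists n.
  have [_ [[n Nn <-] un]] := clpsi _ _ uN (nbhsx_ballx psi _ e16).
  move: Nn; rewrite /= geq_max => /andP[Nn N0n]; exists n => //.
  have [_ hu] := Hu n N0n.
  move: un; rewrite -ball_normE /= distrC => un.
  apply: le_lt_trans (ler_distD (u n) (hn n) psi) _.
  have -> : (1 / 8 : R) = 1 / 16 + 1 / 16 by lra.
  exact: ltrD.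
have close phi1 phi2 A : measurable A -> `|phi1 - phi2| < 1 / 8 ->
    `|\int[m]_(x in A) phi1 x - \int[m]_(x in A) phi2 x| < 1 / 8.
  move=> mA; apply: le_lt_trans.
  have := Rintegral_Lspace1_lin 1 (-1) phi1 phi2 mA.
  rewrite scale1r scaleN1r mul1r mulN1r => <-.
  exact: normr_Rintegral_le_norm.
have psi_leb A : measurable A -> `|fine (m A) - \int[m]_(x in A) psi x| <= 1 / 4.
  move=> mA.
  have e8 : (0 : R) < 1 / 8 by lra.
  have [N _ HN] := (cvgrPdist_lt _ _).1 (iter_half_transfer_mixing hD mA) _ e8.
  have [n Nn npsi] := clpsi N.
  have := HN n Nn; have := close _ _ _ mA npsi; rewrite !ltr_norml ler_norml.
  move: (fine _) (Rintegral m A psi) (Rintegral m A _) => u v w.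
  by move=> /andP[? ?] /andP[? ?]; apply/andP; split; lra.
have [n _ npsi] := clpsi 0%N.
have [A [mA mA2 nA]] := exists_concentration_set h1 n.
have := psi_leb A mA; have := close _ _ _ mA npsi.
rewrite nA mA2 ltr_norml ler_norml.
move: (Rintegral _ _ _) => u /andP[? ?] /andP[? ?]; lra.
Qed.

End not_constrictive.

Theorem proposition1p18 (R : realType) :
  let m : {measure set (unit_interval R) -> \bar R} := lebesgue_unit R in
  let L1 := perron_frobenius m halfl in
  let L2 := perron_frobenius m halfr in
  let Lf := fun phi : LspaceType1 m =>
    (1 / 2 : R) *: L1 phi + (1 / 2 : R) *: L2 phi in
  asymptotically_constrictive Lf /\ ~ constrictive Lf.
Proof.
split; [exact: half_transfer_AC | exact: half_transfer_not_constrictive].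
Qed.
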